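(* Let $G$ be a countable monoid and let $A$, $B$ be Artinian modules over a ring $R$. Let $\Sigma \subset A^G$ be a closed subshift submodule (for example $\Sigma= A^G$). Suppose that $\tau \colon \Sigma \to B^G$ is an injective cellular automaton which is also a module homomorphism. Then for every subshift $\Delta \subset A^G$ contained in $\Sigma$: $\tau(\Delta) \subset B^G$ is a subshift of finite type if and only if $\Delta$ is a subshift of finite type of $A^G$; and $\tau(\Delta)$ is a sofic subshift if and only if $\Delta$ is a sofic subshift.
   Context: Let $G$ be a monoid and $A$ a set. $G$ acts on $A^G$ by $(g\star x)(h)=x(hg)$ for $g,h\in G$, $x\in A^G$. A subshift of $A^G$ is a $G$-invariant subset $\Sigma\subset A^G$ (i.e. $g\star x\in\Sigma$ for all $g\in G$, $x\in\Sigma$); it is not required to be closed. $A^G$ carries the prodiscrete topology (product of discrete topologies), and ''closed'' refers to this topology. For $E\subset G$, $\Sigma_E=\{x|_E : x\in\Sigma\}\subset A^E$. For $D\subset G$ finite and $P\subset A^D$, put $\Sigma(A^G;D,P)=\{x\in A^G : (g\star x)|_D\in P \text{ for all } g\in G\}$; the subsets of $A^G$ of this form are the subshifts of finite type of $A^G$. For sets $A,B$ and a subshift $\Sigma\subset A^G$, a map $\tau\colon\Sigma\to B^G$ is a cellular automaton if there are a finite set $M\subset G$ (memory set) and a map $\mu\colon\Sigma_M\to B$ (local defining map) with $\tau(x)(g)=\mu((g\star x)|_M)$ for all $x\in\Sigma$, $g\in G$. A subshift is sofic if it is the image of a subshift of finite type (of $C^G$ for some alphabet set $C$) under a cellular automaton.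 When $A$ is an $R$-module, $A^G$ is an $R$-module with componentwise operations; a subshift submodule of $A^G$ is a subshift that is also an $R$-submodule. *)

(* Defs.v *)
From HB Require Import structures.
From mathcomp Require Import all_boot all_order all_algebra.
From mathcomp Require Import all_classical topology.

Set Implicit Arguments.
Unset Strict Implicit.
Unset Printing Implicit Defensive.

Import GRing.Theory.

Local Open Scope classical_set_scope.
Local Open Scope ring_scope.

(** A configuration in A^G is a function [G -> A]. A set used as a type
    stands for the subtype [{x | x \in E}], so a pattern in A^E, for [E : set G],
    is a function [E -> A]. *)

Section Subshifts.
Variable G : monoidType.

Definition shift (A : Type) (g : G) (x : G -> A) : G -> A :=
  fun h => x (h * g)%g.

Definition subshift (A : Type) (Sigma : set (G -> A)) : Prop :=
  forall (g : G) (x : G -> A), Sigma x -> Sigma (shift g x).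

Definition restr (A : Type) (E : set G) (x : G -> A) : E -> A :=
  fun h => x (\val h).
Arguments restr {A} E x.

Definition restr_set (A : Type) (E : set G) (Sigma : set (G -> A)) :
    set (E -> A) :=
  restr E @` Sigma.
Arguments restr_set {A} E Sigma.

Definition SFT_of (A : Type) (D : set G) (P : set (D -> A)) : set (G -> A) :=
  [set x | forall g : G, P (restr D (shift g x))].

Definition subshift_of_finite_type (A : Type) (Sigma : set (G -> A)) : Prop :=
  exists (D : set G) (P : set (D -> A)), finite_set D /\ Sigma = SFT_of P.

(** The local defining map [mu] is only defined on the patterns of [Sigma], so
    it is evaluated at the element [p] of [restr_set M Sigma] whose underlying
    pattern is [restr M (shift g x)]; such a [p] exists, and is unique, because
    [Sigma] is a subshift. *)
Definition cellular_automaton (A B : Type) (Sigma : set (G -> A))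
    (tau : Sigma -> (G -> B)) : Prop :=
  subshift Sigma /\
  exists (M : set G) (mu : restr_set M Sigma -> B),
    finite_set M /\
    forall (x : Sigma) (g : G) (p : restr_set M Sigma),
      \val p = restr M (shift g (\val x)) -> tau x g = mu p.

Definition sofic (A : Type) (Sigma : set (G -> A)) : Prop :=
  exists (C : Type) (X : set (G -> C)) (sigma : X -> (G -> A)),
    [/\ subshift_of_finite_type X,
        cellular_automaton sigma
      & Sigma = range sigma].

(** Closedness in A^G for the product of the discrete topologies. *)
Definition prodiscrete_closed (A : choiceType) (Sigma : set (G -> A)) : Prop :=
  closed (Sigma : set (prod_topology (fun _ : G => discrete_topology A))).

End Subshifts.

Section Modules.
Variable R : pzRingType.

Definition submodule (V : lmodType R) (N : set V) : Prop :=
  GRing.submod_closed [in N].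

Definition artinian (V : lmodType R) : Prop :=
  forall N : nat -> set V,
    (forall n, submodule (N n)) ->
    (forall n, N n.+1 `<=` N n) ->
    exists n0 : nat, forall n : nat, (n0 <= n)%N -> N n = N n0.

(** [z] ranges over the elements of [N] equal to [a *: x + y] in [V]; there is
    exactly one when [N] is a submodule. *)
Definition linear_on (V W : lmodType R) (N : set V) (f : N -> W) : Prop :=
  forall (a : R) (x y z : N),
    \val z = a *: \val x + \val y -> f z = a *: f x + f y.

End Modules.

(* Main.v *)
Require Import Defs.
From HB Require Import structures.
From mathcomp Require Import all_boot all_order all_algebra.
From mathcomp Require Import all_classical topology.

(** The whole theorem follows from one fact: the inverse of tau, defined on
    tau(Sigma), is itself a cellular automaton, that is, there is a finite N in G
    such that for x in Sigma the restriction of tau(x) to N determines x(1).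

    Since tau is linear, it is enough that x(1) = 0 whenever tau(x) vanishes on N.
    Exhaust G by finite sets N_n and let K_n be the submodule of those x in Sigma
    for which tau(x) vanishes on N_n. The K_n decrease, are closed, and intersect
    in ker tau = 0. In general the projections of a decreasing sequence of closed
    sets need not commute with its intersection, but they do for submodules of a
    countable power of an Artinian module ([artinian_bigcap_lift]): on a finite set
    of coordinates the projections of the K_n stabilise
    ([artinian_chain_lift]), so an element of a late K_n can be corrected
    step by step, each step freezing one more finite set of coordinates, and the
    corrections converge to an element of the intersection. Hence for large n
    every x in K_n agrees at 1 with an element of the intersection, so
    x(1) = 0 ([linear_finite_recovery]).

    It remains to transport finite type and soficity along tau and its inverse.
    Both are restrictions of maps Phi : A^G -> B^G and Psi : B^G -> A^G defined on
    the full shifts by a finite local rule, chosen arbitrarily on the patterns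
    which do not occur. If Psi (Phi x) = x on Delta, then y lies in Phi(Delta)
    exactly when Psi y lies in Delta and Phi (Psi y) = y. If Delta is of finite
    type, both are conditions on finite windows ([local_iso_image_SFT]). A local image of a sofic shift is sofic by
    composition ([local_image_sofic]). The pair (Phi, Psi) plays a symmetric role,
    so applying the two transfer statements to Phi and Delta, then to Psi and
    Phi(Delta), gives the four implications. *)

Set Implicit Arguments.
Unset Strict Implicit.
Unset Printing Implicit Defensive.

Import GRing.Theory.

Local Open Scope classical_set_scope.
Local Open Scope ring_scope.

(** * Functions of finitely many coordinates *)

Arguments restr {G A} E x.
Arguments restr_set {G A} E Sigma.

Section Windows.

Definition agree_on (I T : Type) (E : set I) (x y : I -> T) : Prop :=
  forall i, E i -> x i = y i.

Definition finite_window (I A T : Type) (F : (I -> A) -> T) : Prop :=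
  exists2 M : set I, finite_set M & forall x y, agree_on M x y -> F x = F y.

(** The window of the composite is the union of the windows of the finitely many
    coordinates of [Phi] that [F] reads. *)
Lemma finite_window_comp (I J A B T : Type) (F : (J -> B) -> T)
    (Phi : (I -> A) -> (J -> B)) :
  finite_window F -> (forall j, finite_window (Phi^~ j)) ->
  finite_window (F \o Phi).
Proof.
move=> [M finM FM] /(_ _)/cid2 winPhi.
pose W j := s2val (winPhi j).
have finW j : finite_set (W j) by rewrite /W; case: (winPhi j).
have PhiW j x y : agree_on (W j) x y -> Phi x j = Phi y j.
  by rewrite /W; case: (winPhi j) => /= W' _; apply.
exists (\bigcup_(j in M) W j); first exact: bigcup_finite.
move=> x y xy; apply: FM => j Mj; apply: PhiW => i Wi.
by apply: xy; exists j.
Qed.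

Lemma finite_window_and (I A : Type) (P Q : (I -> A) -> Prop) :
  finite_window P -> finite_window Q ->
  finite_window (fun x => P x /\ Q x).
Proof.
move=> [M finM PM] [N finN QN]; exists (M `|` N).
  by rewrite finite_setU.
move=> x y xy; rewrite (PM x y) ?(QN x y) // => i ?; apply: xy; [right|left];
  by [].
Qed.

Lemma finite_window_eq (I A T : Type) (F F' : (I -> A) -> T) :
  finite_window F -> finite_window F' ->
  finite_window (fun x => F x = F' x).
Proof.
move=> [M finM FM] [N finN FN]; exists (M `|` N).
  by rewrite finite_setU.
move=> x y xy; rewrite (FM x y) ?(FN x y) // => i ?; apply: xy; [right|left];
  by [].
Qed.

End Windows.

(** * Local maps and cellular automata *)

Section LocalMaps.
Variable G : monoidType.

(** Over all of A^G this is the same as having a finite memory set and a local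
    rule; the intrinsic form makes composition immediate. *)
Definition local_map (A B : Type) (Phi : (G -> A) -> (G -> B)) : Prop :=
  finite_window (Phi^~ 1%g) /\ forall g x, Phi (shift g x) = shift g (Phi x).

Lemma shift_shift (A : Type) (g h : G) (x : G -> A) :
  shift g (shift h x) = shift (g * h)%g x.
Proof. by apply/funext => k; rewrite /shift mulgA. Qed.

Lemma shift1 (A : Type) (g : G) (x : G -> A) : shift g x 1%g = x g.
Proof. by rewrite /shift mul1g. Qed.

Lemma finite_window_at (A : Type) (g : G) :
  finite_window (fun x : G -> A => x g).
Proof. by exists [set g]; [exact: finite_set1|move=> x y; apply]. Qed.

Lemma local_map_window (A B : Type) (Phi : (G -> A) -> (G -> B)) :
  local_map Phi -> forall g, finite_window (Phi^~ g).
Proof.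
move=> [win equiv] g.
have -> : Phi^~ g = (Phi^~ 1%g) \o shift g.
  by apply/funext => x /=; rewrite equiv shift1.
by apply: finite_window_comp win _ => h; exact: finite_window_at.
Qed.

Lemma local_map_comp (A B C : Type) (Psi : (G -> B) -> (G -> C))
    (Phi : (G -> A) -> (G -> B)) :
  local_map Psi -> local_map Phi -> local_map (Psi \o Phi).
Proof.
move=> [winPsi equivPsi] lPhi; split=> [|g x] /=.
  exact: (finite_window_comp winPsi (local_map_window lPhi)).
by rewrite lPhi.2 equivPsi.
Qed.

(** The local rule is prolonged by the constant [b] to the patterns that do not
    occur in [Sigma]. *)
Lemma cellular_automaton_local_map (A B : Type) (b : B) (Sigma : set (G -> A))
    (tau : Sigma -> (G -> B)) :
  cellular_automaton tau ->
  exists2 Phi, local_map Phi & forall x : Sigma, tau x = Phi (\val x).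
Proof.
move=> [shSigma [M [mu [finM tauE]]]].
pose rule (q : M -> A) : B :=
  if pselect (exists p : restr_set M Sigma, \val p = q) is left ex
  then mu (projT1 (cid ex)) else b.
exists (fun x g => rule (restr M (shift g x))).
  split=> [|g x].
    exists M => // x y xy; congr rule; apply/funext => -[m Mm].
    by rewrite /restr /shift /= mulg1 xy //; exact: set_mem.
  by apply/funext => h; rewrite shift_shift.
move=> x; apply/funext => g; rewrite /rule; case: pselect => [ex|[]].
  by case: (cid ex) => p pE /=; exact: tauE.
have patx : restr_set M Sigma (restr M (shift g (\val x))).
  by exists (shift g (\val x)) => //; apply: shSigma; exact: set_valP.
by exists (SigSub (mem_set patx)).
Qed.

Lemma local_map_cellular_automaton (A B : Type) (Sigma : set (G -> A))
    (tau : Sigma -> (G -> B)) (Phi : (G -> A) -> (G -> B)) :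
  subshift Sigma -> local_map Phi -> (forall x : Sigma, tau x = Phi (\val x)) ->
  cellular_automaton tau.
Proof.
move=> shSigma [[M finM PhiM] equiv] tauE; split=> //.
have witness (p : restr_set M Sigma) :
    {x | Sigma x & restr M x = \val p} by exact/cid2/(set_valP p).
exists M, (fun p => Phi (s2val (witness p)) 1%g); split=> // x g p pE.
case: (witness p) => z Sz /= zp.
rewrite tauE -shift1 -equiv; apply: PhiM => m Mm.
have := congr1 (fun q : M -> A => q (SigSub (mem_set Mm))) (etrans zp pE).
by [].
Qed.

(** If a finite window of [Phi x] determines [x] at the identity, equivariance
    recovers [x] everywhere by the same rule: look for some [s] in [Sigma] whose
    image has the observed pattern on [N] and read off its value at the identity. *)
Lemma local_inverse (A B : Type) (a : A) (Phi : (G -> A) -> (G -> B))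
    (Sigma : set (G -> A)) (N : set G) :
  subshift Sigma -> local_map Phi -> finite_set N ->
  (forall x y, Sigma x -> Sigma y -> agree_on N (Phi x) (Phi y) ->
     x 1%g = y 1%g) ->
  exists2 Psi, local_map Psi & forall x, Sigma x -> Psi (Phi x) = x.
Proof.
move=> shSigma lPhi finN recover.
pose guess (y : G -> B) : A :=
  if pselect (exists2 s, Sigma s & agree_on N (Phi s) y) is left ex
  then s2val (cid2 ex) 1%g else a.
exists (fun y g => guess (shift g y)).
  split=> [|g y]; last by apply/funext => h; rewrite shift_shift.
  exists N => // y z yz; rewrite /guess.
  suff -> : (fun s => agree_on N (Phi s) (shift 1 y)) =
            (fun s => agree_on N (Phi s) (shift 1 z)) by [].
  by apply/funext => s; apply/propext; split=> e n Nn;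
     rewrite e // /shift mulg1 yz.
move=> x Sx; apply/funext => g; rewrite /guess; case: pselect => [ex|[]].
  case: (cid2 ex) => s Ss /= sx; rewrite -(shift1 g x).
  by apply: recover => //; [exact: shSigma|rewrite lPhi.2].
by exists (shift g x); [exact: shSigma|rewrite lPhi.2].
Qed.

(** * Transfer of finite type and soficity *)

(** A set of patterns over a finite [D] is a predicate on configurations that
    reads only [D]; in this form windows can be enlarged and pulled back without
    changing the type of the patterns. *)
Lemma subshift_of_finite_typeP (A : Type) (Sigma : set (G -> A)) :
  subshift_of_finite_type Sigma <->
  exists2 Q : set (G -> A), finite_window Q &
    Sigma = [set x | forall g, Q (shift g x)].
Proof.
split=> [[D [P [finD ->]]]|[Q [D finD QD] ->]].
  exists (fun x => P (restr D x)) => //; exists D => // x y xy.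
  by congr P; apply/funext => -[d Dd]; apply: xy; exact: set_mem.
exists D, [set p | exists2 x, Q x & restr D x = p]; split=> //.
apply/seteqP; split=> [x Qx g|x Px g] /=; first by exists (shift g x).
have [y Qy yx] := Px g; suff -> : Q (shift g x) = Q y by [].
apply: QD => d Dd.
by have /esym := congr1 (fun q : D -> A => q (SigSub (mem_set Dd))) yx.
Qed.

Lemma shift_SFT (A : Type) (Sigma : set (G -> A)) :
  subshift_of_finite_type Sigma -> subshift Sigma.
Proof.
move=> /subshift_of_finite_typeP[Q _ ->] g x Qx h.
by rewrite shift_shift; exact: Qx.
Qed.

(** [Phi @` Delta] is cut out by the conditions [Delta (Psi y)] and
    [Phi (Psi y) = y]; by equivariance the second only has to be imposed at the
    identity of every translate. *)
Lemma local_iso_image_SFT (A B : Type) (Phi : (G -> A) -> (G -> B))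
    (Psi : (G -> B) -> (G -> A)) (Delta : set (G -> A)) :
  local_map Phi -> local_map Psi -> (forall x, Delta x -> Psi (Phi x) = x) ->
  subshift_of_finite_type Delta -> subshift_of_finite_type (Phi @` Delta).
Proof.
move=> lPhi lPsi PhiK /subshift_of_finite_typeP[Q winQ DeltaE].
apply/subshift_of_finite_typeP.
exists (fun y => (Q \o Psi) y /\ (Phi \o Psi) y 1%g = y 1%g).
  apply: finite_window_and.
    exact: finite_window_comp winQ (local_map_window lPsi).
  apply: finite_window_eq; last exact: finite_window_at.
  exact: local_map_window (local_map_comp lPhi lPsi) _.
apply/seteqP; split=> [_ [x Dx <-] g|y Hy] /=.
  rewrite !lPsi.2 PhiK // lPhi.2; split=> //.
  by move: Dx; rewrite DeltaE; apply.
have PhiPsi : Phi (Psi y) = y.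
  apply/funext => g; have [_ /=] := Hy g.
  by rewrite lPsi.2 lPhi.2 !shift1.
exists (Psi y) => //; rewrite DeltaE => g /=.
by rewrite -lPsi.2; have [] := Hy g.
Qed.

Lemma local_image_sofic (A B : Type) (a : A) (Phi : (G -> A) -> (G -> B))
    (Delta : set (G -> A)) :
  local_map Phi -> sofic Delta -> sofic (Phi @` Delta).
Proof.
move=> lPhi [C [X [sigma [sftX caS DeltaE]]]].
have [S lS SE] := cellular_automaton_local_map a caS.
exists C, X, (Phi \o sigma); split=> //.
  apply: (local_map_cellular_automaton (shift_SFT sftX) (local_map_comp lPhi lS)).
  by move=> x /=; rewrite SE.
by rewrite DeltaE image_comp.
Qed.

End LocalMaps.

(** * Compactness over Artinian modules *)

Section LinearCompactness.
Variable R : pzRingType.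

Definition cylinder_closed (I A : Type) (S : set (I -> A)) : Prop :=
  forall x, (forall E, finite_set E -> exists2 z, S z & agree_on E z x) -> S x.

(** The sets of points of [S] that agree with [x] on a given finite set form a
    filter base converging to [x]. *)
Lemma prodiscrete_closed_cylinder (G : monoidType) (A : choiceType)
    (S : set (G -> A)) :
  prodiscrete_closed S -> cylinder_closed S.
Proof.
move=> clS x approx.
pose V := prod_topology (fun _ : G => discrete_topology A).
pose F : set_system V :=
  filter_from (@finite_set G) (fun E => [set z | S z /\ agree_on E z x]).
have FF : ProperFilter F.
  apply: filter_from_proper; last by move=> E /approx[z Sz zx]; exists z.
  apply: filter_from_filter; first by exists set0; exact: finite_set0.
  move=> E E' finE finE'; exists (E `|` E'); first by rewrite finite_setU.
  by move=> z [Sz zx]; split; split=> // i ?; apply: zx; [left|right].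
apply: (@closed_cvg V V F FF id S clS _ x).
  by exists set0; [exact: finite_set0|move=> z []].
apply/cvg_sup => g U [W [[O oO <-] Ox] OU].
exists [set g]; first exact: finite_set1.
by move=> z [_ zx]; apply: OU; rewrite /= zx.
Qed.

Lemma antitone_seq (T : Type) (N : nat -> set T) :
  (forall n, N n.+1 `<=` N n) -> forall m n, (m <= n)%N -> N n `<=` N m.
Proof.
move=> decN m n /subnK <-; elim: (n - m)%N => // k IHk.
exact: subset_trans (decN _) IHk.
Qed.

Section Submodule.
Variables (V : lmodType R) (N : set V).
Hypothesis subN : submodule N.

Lemma submodule0 : N 0.
Proof. by have [/set_mem] := subN. Qed.

Lemma submodule_lin a x y : N x -> N y -> N (a *: x + y).
Proof.
by move=> Nx Ny; apply: set_mem; apply: subN.2; exact: mem_set.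
Qed.

Lemma submoduleD x y : N x -> N y -> N (x + y).
Proof. by move=> Nx /(submodule_lin 1 Nx); rewrite scale1r. Qed.

Lemma submoduleB x y : N x -> N y -> N (x - y).
Proof.
by move=> Nx Ny; rewrite addrC -scaleN1r; exact: submodule_lin.
Qed.

End Submodule.

Lemma submoduleP (V : lmodType R) (N : set V) :
  N 0 -> (forall a x y, N x -> N y -> N (a *: x + y)) -> submodule N.
Proof.
move=> N0 Nlin; split; first exact: mem_set.
by move=> a x y /set_mem Nx /set_mem Ny; apply/mem_set/Nlin.
Qed.

(** A descending chain of submodules stabilises after projection to
    finitely many coordinates, which is the fact that a finite power of an
    Artinian module is Artinian. The coordinates are added one at a time:
    if the projections to [s] are stable from [m0] on, the new coordinate is
    handled by the chain of the values at [i] of the elements that vanish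
    on [s]. *)
Lemma artinian_chain_lift (I : choiceType) (V : lmodType R)
    (N : nat -> set (I -> V)) (E : set I) :
  artinian V -> (forall n, submodule (N n)) -> (forall n, N n.+1 `<=` N n) ->
  finite_set E ->
  exists m0, forall m x, N m0 x -> exists2 y, N m y & agree_on E y x.
Proof.
move=> artV subN decN /finite_seqP[s ->].
elim: s => [|i s [m0 lift_s]].
  by exists 0%N => m x _; exists 0 => //; exact: submodule0.
pose N' m : set V :=
  [set v | exists x, [/\ N m x, agree_on [set` s] x 0 & x i = v]].
have subN' m : submodule (N' m).
  apply: submoduleP; first by exists 0; split=> //; exact: submodule0.
  move=> a _ _ [x [Nx xs <-]] [y [Ny ys <-]]; exists (a *: x + y).
  split=> //; first exact: submodule_lin.
  by move=> j sj; rewrite fctE /= fctE xs // ys // scaler0 addr0.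
have decN' m : N' m.+1 `<=` N' m.
  by move=> _ [x [Nx xs <-]]; exists x; split=> //; exact: decN.
have [m1 stab] := artV N' subN' decN'.
have antiN := antitone_seq decN.
exists (maxn m0 m1) => m x Nx; pose k := maxn m (maxn m0 m1).
(* [y] is right on [s]; an element of [N k] that vanishes on [s] corrects its
   value at [i] *)
have [y Ny yx] := lift_s k x (antiN _ _ (leq_maxl _ _) _ Nx).
have : N' (maxn m0 m1) (x i - y i).
  exists (x - y); split=> //.
    by apply: submoduleB => //; apply: antiN Ny; exact: leq_maxr.
  by move=> j sj; rewrite fctE /= fctE yx // subrr.
rewrite stab ?leq_maxr // -(stab k) => [[z [Nz zs zi]]|]; last first.
  by rewrite /k !leq_max leqnn !orbT.
exists (y + z).
  by apply: (antiN m k (leq_maxl _ _)); exact: (submoduleD (subN k)).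
move=> j; rewrite /= inE => /predU1P[->|sj]; rewrite fctE.
  by rewrite zi addrC subrK.
by rewrite zs // addr0 yx.
Qed.

Lemma finite_set_bounded (T : choiceType) (f : T -> nat) (E : set T) :
  finite_set E -> exists n, forall i, E i -> (f i < n)%N.
Proof.
move=> /finite_seqP[s ->]; exists (\max_(i <- s) f i).+1 => i /= si.
by rewrite ltnS; exact: leq_bigmax_seq.
Qed.

(** A Mittag-Leffler argument. By the previous lemma, [x] in a late enough term
    can be replaced, without changing it on a finite set, by an element of an
    arbitrarily late term. Iterating along an exhaustion of [I] by finite sets
    gives a sequence that is eventually constant at each coordinate, and its limit
    lies in every term because these are closed. *)
Lemma artinian_bigcap_lift (I : choiceType) (V : lmodType R)
    (N : nat -> set (I -> V)) (E : set I) :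
  countable [set: I] -> artinian V ->
  (forall n, submodule (N n)) -> (forall n, N n.+1 `<=` N n) ->
  (forall n, cylinder_closed (N n)) -> finite_set E ->
  exists m, forall x, N m x ->
    exists2 y, (forall n, N n y) & agree_on E y x.
Proof.
move=> /countable_injP[f injf] artV subN decN clN finE.
have antiN := antitone_seq decN.
pose B n : set I := [set i | (f i < n)%N].
have finB n : finite_set (B n).
  apply: (@finite_preimage _ _ `I_n f); last exact: finite_II.
  by move=> i j _ _; apply: injf; rewrite inE.
have /choice[m mP] n := artinian_chain_lift artV subN decN (finB n).
have [n0 En0] := finite_set_bounded f finE.
(* [m (n0 + n)] makes the next correction possible, while the summand [n] drives
   the sequence into every term of the chain *)
pose p n := (m (n0 + n) + n)%N.
have step_ex (ny : nat * (I -> V)) : exists z, N (p ny.1) ny.2 ->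
    N (p ny.1.+1) z /\ agree_on (B (n0 + ny.1)) z ny.2.
  case: ny => n y /=; have [Ny|] := pselect (N (p n) y); last by exists y.
  have [z Nz zy] := mP _ (p n.+1) y (antiN _ _ (leq_addr _ _) _ Ny).
  by exists z.
have /choice[step stepP] := step_ex.
exists (p 0%N) => x Nx.
pose y n := iteri n (fun k z => step (k, z)) x.
have Ny n : N (p n) (y n).
  by elim: n => // n /(stepP (n, _))[].
have yS n : agree_on (B (n0 + n)) (y n.+1) (y n).
  by have [] := stepP (n, _) (Ny n).
have y_stable k n : (k <= n)%N -> agree_on (B (n0 + k)) (y n) (y k).
  move=> /subnK <-; elim: (n - k)%N => // d IHd i Bi.
  rewrite addSn yS ?IHd //; apply: leq_trans Bi _.
  by rewrite leq_add2l leq_addl.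
(* from index [(f i).+1] on, the coordinate [i] is frozen *)
pose l i := y (f i).+1 i.
have l_agree n : agree_on (B (n0 + n)) l (y n).
  move=> i Bi; rewrite /l; have [le_n|/ltnW le_n] := leqP n (f i).+1.
    exact: y_stable le_n _ Bi.
  by apply/esym/(y_stable _ _ le_n); exact: leq_addl.
exists l => [n|i Ei]; last first.
  apply: (l_agree 0%N); apply: leq_trans (En0 _ Ei) (leq_addr _ _).
apply: clN => E' /(finite_set_bounded f)[k E'k]; exists (y (maxn n k)).
  by apply: antiN (Ny _); apply: leq_trans (leq_maxl n k) (leq_addl _ _).
move=> i E'i; apply/esym/l_agree; apply: leq_trans (E'k _ E'i) _.
by apply: leq_trans (leq_maxr n k) (leq_addl _ _).
Qed.

(** The inverse of an injective linear map on a closed submodule is continuous: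
    each coordinate of [x] is determined by finitely many coordinates of [Phi x].
    The submodules of those [x] for which [Phi x] vanishes on larger and larger
    finite sets are closed and intersect in the kernel, hence eventually vanish at
    the coordinate [i]. *)
Lemma linear_finite_recovery (I J : choiceType) (A B : lmodType R)
    (Sigma : set (I -> A)) (Phi : (I -> A) -> (J -> B)) :
  countable [set: I] -> countable [set: J] -> artinian A ->
  submodule Sigma -> cylinder_closed Sigma ->
  (forall j, finite_window (Phi^~ j)) ->
  (forall a x y, Sigma x -> Sigma y ->
     Phi (a *: x + y) = a *: Phi x + Phi y) ->
  (forall x y, Sigma x -> Sigma y -> Phi x = Phi y -> x = y) ->
  forall i, exists2 N, finite_set N &
    forall x y, Sigma x -> Sigma y -> agree_on N (Phi x) (Phi y) -> x i = y i.
Proof.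
move=> cI /countable_injP[f injf] artA subS clS winPhi linPhi injPhi i.
have PhiB x y : Sigma x -> Sigma y -> Phi (x - y) = Phi x - Phi y.
  by move=> Sx Sy; rewrite addrC -scaleN1r linPhi // scaleN1r addrC.
have Phi0 : Phi 0 = 0.
  by rewrite -{1}(subrr 0) PhiB ?subrr //; exact: submodule0.
pose K n : set (I -> A) :=
  Sigma `&` [set x | agree_on [set j | (f j < n)%N] (Phi x) 0].
have subK n : submodule (K n).
  apply: submoduleP => [|a x y [Sx x0] [Sy y0]].
    by split; [exact: submodule0|move=> j _; rewrite Phi0].
  split=> [|j jn]; first exact: submodule_lin.
  by rewrite linPhi // fctE /= fctE x0 // y0 // scaler0 addr0.
have decK n : K n.+1 `<=` K n.
  by move=> x [Sx x0]; split=> // j jn; apply: x0; exact: ltnW.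
have clK n : cylinder_closed (K n).
  move=> x approx; split=> [|j jn].
    by apply: clS => E /approx[z [Sz _] zx]; exists z.
  have [W finW PhiW] := winPhi j.
  have [z [_ z0] zx] := approx W finW.
  by rewrite -(PhiW _ _ zx) z0.
have [m mP] := artinian_bigcap_lift cI artA subK decK clK (finite_set1 i).
exists [set j | (f j < m)%N].
  apply: (@finite_preimage _ _ `I_m f); last exact: finite_II.
  by move=> j k _ _; apply: injf; rewrite inE.
move=> x y Sx Sy xy.
have Kxy : K m (x - y).
  split=> [|j jm]; first exact: submoduleB.
  by rewrite PhiB // fctE /= fctE xy // subrr.
have [z zK zi] := mP _ Kxy.
have z0 : z = 0.
  apply: injPhi; [exact: (zK 0%N).1|exact: submodule0|].
  by rewrite Phi0; apply/funext => j; apply: (zK (f j).+1).2 => /=.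
have /esym/eqP := zi i erefl.
by rewrite z0 fctE /= fctE subr_eq0 => /eqP.
Qed.

End LinearCompactness.

(** * Reversible images of subshifts *)

Theorem theoremB (G : monoidType) (R : pzRingType) (A B : lmodType R)
    (Sigma : set (G -> A)) (tau : Sigma -> (G -> B)) :
  countable [set: G] ->
  artinian A ->
  artinian B ->
  subshift Sigma ->
  submodule Sigma ->
  prodiscrete_closed Sigma ->
  injective tau ->
  cellular_automaton tau ->
  linear_on tau ->
  forall Delta : set (G -> A),
    subshift Delta ->
    Delta `<=` Sigma ->
    (subshift_of_finite_type (tau @` [set x | Delta (\val x)]) <->
     subshift_of_finite_type Delta) /\
    (sofic (tau @` [set x | Delta (\val x)]) <-> sofic Delta).
Proof.
move=> cG artA _ shS subS clS injtau catau lintau Delta _ DS.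
have [Phi lPhi tauE] := cellular_automaton_local_map (0 : B) catau.
have PhiE x (Sx : Sigma x) : Phi x = tau (SigSub (mem_set Sx)).
  by rewrite tauE.
have linPhi a x y : Sigma x -> Sigma y ->
    Phi (a *: x + y) = a *: Phi x + Phi y.
  move=> Sx Sy; have Sz := submodule_lin subS a Sx Sy.
  by rewrite (PhiE _ Sx) (PhiE _ Sy) (PhiE _ Sz); exact: lintau.
have injPhi x y : Sigma x -> Sigma y -> Phi x = Phi y -> x = y.
  by move=> Sx Sy; rewrite (PhiE _ Sx) (PhiE _ Sy) => /injtau[].
have [N finN recover] := linear_finite_recovery cG cG artA subS
  (prodiscrete_closed_cylinder clS) (local_map_window lPhi) linPhi injPhi 1%g.
have [Psi lPsi PhiK] := local_inverse (0 : A) shS lPhi finN recover.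
have -> : tau @` [set x | Delta (\val x)] = Phi @` Delta.
  apply/seteqP; split=> [_ [x Dx <-]|_ [x Dx <-]].
    by exists (\val x) => //; rewrite tauE.
  by exists (SigSub (mem_set (DS _ Dx))) => //; rewrite tauE.
have DeltaE : Psi @` (Phi @` Delta) = Delta.
  apply/seteqP; split=> [_ [_ [x Dx <-] <-]|x Dx].
    by rewrite PhiK //; exact: DS.
  by exists (Phi x); [exists x|rewrite PhiK //; exact: DS].
split; split=> [h|].
- rewrite -DeltaE; apply: local_iso_image_SFT lPsi lPhi _ h.
  by move=> _ [x Dx <-]; rewrite PhiK //; exact: DS.
- by apply: local_iso_image_SFT lPhi lPsi _ => x /DS; exact: PhiK.
- by rewrite -DeltaE; exact: (local_image_sofic (0 : B) lPsi h).
- exact: (local_image_sofic (0 : A) lPhi).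
Qed.
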